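(* Let $k$ be a field of characteristic zero and let $\mathfrak{g}$ be a Lie algebra over $k$ admitting an LR-structure. Then $\mathfrak{g}$ is two-step solvable.
   Context: An LR-structure on a Lie algebra $\mathfrak{g}$ over $k$ is a bilinear product $\mathfrak{g}\times\mathfrak{g}\to\mathfrak{g}$, $(x,y)\mapsto x\cdot y$, satisfying for all $x,y,z\in\mathfrak{g}$: $x\cdot(y\cdot z)=y\cdot(x\cdot z)$, $(x\cdot y)\cdot z=(x\cdot z)\cdot y$, and $[x,y]=x\cdot y-y\cdot x$. Two-step solvable means $[[\mathfrak{g},\mathfrak{g}],[\mathfrak{g},\mathfrak{g}]]=0$ (derived length at most two). *)

(* Defs.v *)
From HB Require Import structures.
From mathcomp Require Import all_boot all_algebra.

Set Implicit Arguments.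
Unset Strict Implicit.
Unset Printing Implicit Defensive.

Import GRing.Theory.
Local Open Scope ring_scope.

(* No finiteness condition is put on the underlying module. *)
HB.mixin Record Lmodule_isLieAlgebra (R : comNzRingType) (V : Type)
    of GRing.Lmodule R V := {
  lie : V -> V -> V;
  lie_bilinear : bilinear_for *:%R *:%R lie;
  liexx : forall x, lie x x = 0;
  lie_jacobi : forall x y z,
    lie x (lie y z) + lie y (lie z x) + lie z (lie x y) = 0
}.

#[short(type="lieAlgType")]
HB.structure Definition LieAlgebra (R : comNzRingType) :=
  { V of GRing.Lmodule R V & Lmodule_isLieAlgebra R V }.

HB.instance Definition _ (R : comNzRingType) (L : lieAlgType R) :=
  bilinear_isBilinear.Build R L L L _ _ (@lie R L) (@lie_bilinear R L).

Record is_LR_structure (R : comNzRingType) (L : lieAlgType R)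
    (dot : {bilinear L -> L -> L}) : Prop := IsLRStructure {
  LR_left : forall x y z, dot x (dot y z) = dot y (dot x z);
  LR_right : forall x y z, dot (dot x y) z = dot (dot x z) y;
  LR_lie : forall x y, lie x y = dot x y - dot y x
}.

Definition admits_LR_structure (R : comNzRingType) (L : lieAlgType R) : Prop :=
  exists dot : {bilinear L -> L -> L}, is_LR_structure dot.

(* Subspaces are Prop-valued predicates: {vspace _} is available only in finite
   dimension. *)
Inductive lin_span (R : nzRingType) (V : lmodType R) (S : V -> Prop) :
    V -> Prop :=
| lin_span0 : lin_span S 0
| lin_spanD (a : R) (u v : V) : S u -> lin_span S v -> lin_span S (a *: u + v).

Definition lie_prod (R : comNzRingType) (L : lieAlgType R) (A B : L -> Prop) :
    L -> Prop :=
  lin_span (fun x => exists a b, [/\ A a, B b & x = lie a b]).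

Fixpoint derived_series (R : comNzRingType) (L : lieAlgType R) (n : nat) :
    L -> Prop :=
  if n is m.+1 then lie_prod (@derived_series R L m) (@derived_series R L m)
  else fun=> True.

Definition two_step_solvable (R : comNzRingType) (L : lieAlgType R) : Prop :=
  forall x : L, derived_series 2 x -> x = 0.

(* Main.v *)
Require Import Defs.
From mathcomp Require Import all_boot all_algebra.
Import GRing.Theory.
Local Open Scope ring_scope.

(** In an algebra whose left multiplications commute with each other and whose
    right multiplications commute with each other, any two products commute:
    [(ab)(cd) = (cd)(ab)] ([LR_prodC]).  Indeed
      [(ab)(cd) = (a(cd))b = (c(ad))b = (cb)(ad)]
    exchanges [a] and [c], and dually
      [(ab)(cd) = c((ab)d) = c((ad)b) = (ad)(cb)]
    exchanges [b] and [d]; doing both exchanges the two products.  As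
    [[x, y] = xy - yx] is a difference of products, a bracket of two brackets
    vanishes ([LR_lie_lie]), and bilinearity ([lin_span_lie0]) extends this
    to the linear spans that make up the derived series. *)

Lemma lin_span_lie0 (R : comNzRingType) (L : lieAlgType R) (S T : L -> Prop) :
    (forall x y, S x -> T y -> lie x y = 0) ->
  forall x y, lin_span S x -> lin_span T y -> lie x y = 0.
Proof.
move=> ST0 x y Sx Ty.
have Sy0 z : S z -> lie z y = 0.
  move=> Sz; elim: Ty => [|a u v Tu _ IHv]; first exact: linear0r.
  by rewrite linearPr /= ST0 // IHv scaler0 addr0.
elim: Sx => [|a u v Su _ IHv]; first exact: linear0l.
by rewrite linearPl /= Sy0 // IHv scaler0 addr0.
Qed.

Lemma LR_swap_left (R : comNzRingType) (L : lieAlgType R)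
    (dot : {bilinear L -> L -> L}) (LRdot : is_LR_structure dot) a b c d :
  dot (dot a b) (dot c d) = dot (dot c b) (dot a d).
Proof.
by rewrite (LR_right LRdot) (LR_left LRdot a) (LR_right LRdot c (dot a d)).
Qed.

Lemma LR_swap_right (R : comNzRingType) (L : lieAlgType R)
    (dot : {bilinear L -> L -> L}) (LRdot : is_LR_structure dot) a b c d :
  dot (dot a b) (dot c d) = dot (dot a d) (dot c b).
Proof.
by rewrite (LR_left LRdot) (LR_right LRdot a) (LR_left LRdot c (dot a d)).
Qed.

Lemma LR_prodC (R : comNzRingType) (L : lieAlgType R)
    (dot : {bilinear L -> L -> L}) (LRdot : is_LR_structure dot) a b c d :
  dot (dot a b) (dot c d) = dot (dot c d) (dot a b).
Proof. by rewrite (LR_swap_left _ _ _ LRdot) (LR_swap_right _ _ _ LRdot). Qed.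

Lemma LR_lie_lie (R : comNzRingType) (L : lieAlgType R)
    (dot : {bilinear L -> L -> L}) (LRdot : is_LR_structure dot) (a b c d : L) :
  lie (lie a b) (lie c d) = 0.
Proof.
have lie_prod0 p q r s : lie (dot p q) (dot r s) = 0.
  by rewrite (LR_lie LRdot) (LR_prodC _ _ _ LRdot) subrr.
rewrite (LR_lie LRdot a) (LR_lie LRdot c).
by rewrite linearBl !linearBr /= !lie_prod0 !subr0.
Qed.

Lemma LR_two_step_solvable (R : comNzRingType) (L : lieAlgType R) :
  admits_LR_structure L -> two_step_solvable L.
Proof.
case=> dot LRdot.
have D1_abelian (x y : L) :
    derived_series 1 x -> derived_series 1 y -> lie x y = 0.
  apply: lin_span_lie0 => _ _ [a [b [_ _ ->]]] [c [d [_ _ ->]]].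
  exact: (LR_lie_lie _ _ _ LRdot).
move=> x; elim=> [//|k _ v [a [b [D1a D1b ->]]] _ ->].
by rewrite D1_abelian // scaler0 addr0.
Qed.

Theorem proposition2p1 (k : fieldType) (char0 : [pchar k] =i pred0)
  (g : lieAlgType k) (LR : admits_LR_structure g) : two_step_solvable g.
Proof. exact: LR_two_step_solvable. Qed.
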